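(* Let $H=(A,B,E)$ be a bipartite graph with $|A|=a$, $|B|=b$ and $m=a+b$ vertices, and write $\widetilde{T}_H(x,y)=\sum_{i,j} t_{i,j}(H)x^iy^j$. Then for every integer $0\le h<m$, $$\sum_{i=0}^h\sum_{j=0}^{h-i}\binom{h-i}{j}(-1)^jt_{i,j}(H)=0,$$ and for every integer $h=m+k$ with $k\geq 0$, $$\sum_{i=0}^h\sum_{j=0}^{h-i}\binom{h-i}{j}(-1)^jt_{i,j}(H)=(-1)^{b}\,\mathrm{alt}(H)\binom{b+k}{k}.$$
   Context: A bipartite graph $H=(A,B,E)$ comes with designated sides $A,B$ (isolated vertices allowed). For $m=|V(H)|$ and a permutation $\pi$ of $V(H)$ (a bijection to $[m]$), a vertex $i\in A$ is internally active if $\pi(i)>\pi(j)$ for all neighbours $j$ of $i$, and $j\in B$ is externally active if $\pi(j)>\pi(i)$ for all neighbours $i$ of $j$ (vacuous for isolated vertices); $\mathrm{ia}(\pi),\mathrm{ea}(\pi)$ are their numbers, and $\widetilde{T}_H(x,y)=\frac{1}{m!}\sum_{\pi}x^{\mathrm{ia}(\pi)}y^{\mathrm{ea}(\pi)}$. If $\ell$ is the number of isolated vertices in $B$, the alternating number is $\mathrm{alt}(H)=t_{a,\ell}(H)$. *)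

(* Defs.v *)
From HB Require Import structures.
From mathcomp Require Import all_boot all_order all_algebra.

Set Implicit Arguments.
Unset Strict Implicit.
Unset Printing Implicit Defensive.

Import Order.TTheory GRing.Theory Num.Theory.

Local Open Scope ring_scope.

(* A finite bipartite graph with designated sides A and B is given by its     *)
(* adjacency relation E : A -> B -> bool. Its vertex set is the disjoint sum  *)
(* A + B.                                                                     *)
Section BipartiteGraph.

Variables (A B : finType) (E : A -> B -> bool).

Definition nvert : nat := #|{: A + B}|.

(* [m] is encoded as 'I_m, that is, {0, ..., m - 1}: only the relative order  *)
(* of the values of a permutation matters. An injective function between      *)
(* finite types of equal cardinality is a bijection.                          *)
Definition vperms : {set {ffun A + B -> 'I_nvert}} :=
  [set p : {ffun A + B -> 'I_nvert} | injectiveb p].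

Implicit Type p : {ffun A + B -> 'I_nvert}.

Definition int_active p (i : A) : bool :=
  [forall j : B, E i j ==> (p (inr j) < p (inl i))%N].

Definition ext_active p (j : B) : bool :=
  [forall i : A, E i j ==> (p (inl i) < p (inr j))%N].

Definition ia p : nat := #|[set i | int_active p i]|.

Definition ea p : nat := #|[set j | ext_active p j]|.

(* Q[x, y] is represented as Q[x][y]: x is 'X%:P and y is the outer 'X.       *)
Definition Ttilde : {poly {poly rat}} :=
  ((nvert`!)%:R^-1 : rat)%:P *:
    \sum_(p in vperms) ('X%:P ^+ ia p * 'X ^+ ea p).

(* Coefficient of x^i y^j. *)
Definition tcoef (i j : nat) : rat := (Ttilde`_j)`_i.

Definition isolatedB : {set B} := [set j | [forall i : A, ~~ E i j]].

Definition alt_num : rat := tcoef #|A| #|isolatedB|.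

End BipartiteGraph.

(* Main.v *)
Require Import Defs.
From HB Require Import structures.
From mathcomp Require Import all_boot all_order all_algebra.

Set Implicit Arguments.
Unset Strict Implicit.
Unset Printing Implicit Defensive.

Import Order.TTheory GRing.Theory Num.Theory.

Local Open Scope ring_scope.

(* Multiplying the generating function of the alternating sums by            *)
(* (1 - z)^(b+1) turns the theorem into the statement that                    *)
(* T(x, y) = alt x^a y^b on the hyperbola (x - 1)(y - 1) = 1, that is,         *)
(*   sum_p z^(ia p + ea p) (z - 1)^(b - ea p) = N z^m                          *)
(* where N counts the permutations p whose A-vertices are all active. Write    *)
(* z = (z - 1) + 1 for each active vertex and expand: the left-hand side is a  *)
(* sum of (z - 1)^|W| over pairs (p, W), W a set of vertices, such that every  *)
(* i in A inside W and every j in B outside W is active. Put U = p(W) and      *)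
(* relabel the positions so that U comes first, in increasing order, and is    *)
(* followed by its complement in decreasing order: (p, W) is admissible iff    *)
(* the relabelled permutation has all its A-vertices active. Hence each U      *)
(* contributes N (z - 1)^|U|, and these sum to N z^m.                          *)

(** In the notation above, [activity_expansion] expands over W and [split_at_refold] relabels;
    together they give [activity_on_hyperbola]. Divide that identity by (1 - z)^(b+1): a permutation
    with [ia] = s and [ea] = t contributes, up to sign, z^(s+t) / (1 - z)^(t+1), whose coefficient
    at z^h is C(h-s, t). The other side becomes N z^m / (1 - z)^(b+1), which has no term below z^m
    and coefficient N C(b+k, k) at z^(m+k). *)

Section FoldOrder.

Variables (n : nat) (U : {set 'I_n}).
Implicit Types s t : 'I_n.

(* The total order listing U increasingly and then its complement decreasingly. *)
Definition fold_lt s t : bool :=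
  if t \in U then (s \in U) && (s < t)%N else (s \in U) || (t < s)%N.

Lemma fold_lt_irr s : fold_lt s s = false.
Proof. by rewrite /fold_lt; case: ifP => //= ->; rewrite ltnn. Qed.

Lemma fold_lt_trans s t r : fold_lt s t -> fold_lt t r -> fold_lt s r.
Proof.
rewrite /fold_lt; case: (s \in U); case: (t \in U); case: (r \in U) => //=.
- exact: ltn_trans.
- by move=> st tr; apply: ltn_trans st.
Qed.

Lemma fold_lt_total s t : s != t -> fold_lt s t || fold_lt t s.
Proof.
rewrite -val_eqE /= neq_ltn /fold_lt.
by case: (s \in U); case: (t \in U) => //= /orP[]->; rewrite ?orbT.
Qed.

(** The shape of [split_at]: for s and t the positions of adjacent vertices of A and B, the two
    implications are their activity conditions. *)
Lemma fold_ltE s t :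
  fold_lt t s = ((s \in U) ==> (t < s)%N) && ((t \notin U) ==> (s < t)%N).
Proof.
by rewrite /fold_lt; case: (s \in U); case: (t \in U); rewrite /= ?andbT //; case: ltngtP.
Qed.

Fact fold_rank_subproof t : (#|[set s | fold_lt s t]| < n)%N.
Proof.
rewrite -[X in (_ < X)%N](card_ord n) -cardsT; apply: proper_card.
by apply/properP; split; [exact: subsetT | exists t; rewrite ?inE ?fold_lt_irr].
Qed.

Definition fold_rank t : 'I_n := Ordinal (fold_rank_subproof t).

Lemma fold_rank_homo s t : fold_lt s t -> (fold_rank s < fold_rank t)%N.
Proof.
move=> st; apply: proper_card; apply/properP; split.
  by apply/subsetP => r; rewrite !inE => /fold_lt_trans; apply.
by exists s; rewrite !inE ?fold_lt_irr.
Qed.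

Lemma fold_rank_lt s t : (fold_rank s < fold_rank t)%N = fold_lt s t.
Proof.
apply/idP/idP => [st|]; last exact: fold_rank_homo.
have [eqst|/fold_lt_total/orP[//|/fold_rank_homo ts]] := eqVneq s t.
  by rewrite eqst ltnn in st.
by have := ltn_trans st ts; rewrite ltnn.
Qed.

Lemma fold_rank_inj : injective fold_rank.
Proof.
move=> s t eq_st; apply/eqP; apply: contraT => /fold_lt_total.
by rewrite -!fold_rank_lt eq_st ltnn.
Qed.

End FoldOrder.

Section Expansion.

Variables (A B : finType) (E : A -> B -> bool).
Local Notation V := (A + B)%type.
Local Notation perms := (vperms A B).
Implicit Types (p : {ffun V -> 'I_(nvert A B)}) (W : {set V}).

Definition topA p : bool := [forall i, int_active E p i].

Definition split_at p W : bool :=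
  [forall v : V, match v with
    | inl i => (v \in W) ==> int_active E p i
    | inr j => (v \notin W) ==> ext_active E p j
    end].

Lemma leq_ea p : (ea E p <= #|B|)%N.
Proof. exact: max_card. Qed.

Lemma activity_expansion (R : comNzRingType) (x : R) p :
  x ^+ (ia E p + ea E p) * (x - 1) ^+ (#|B| - ea E p) =
  \sum_W (split_at p W)%:R * (x - 1) ^+ #|W|.
Proof.
(* [F] is the factor of a vertex put in W, [G] that of a vertex left out; [F v + G v] is x if v is
   active, and otherwise 1 on A and x - 1 on B. *)
pose F (v : V) : R :=
  (if v is inl i then int_active E p i else true)%:R * (x - 1).
pose G (v : V) : R :=
  (if v is inr j then ext_active E p j else true)%:R.
transitivity (\prod_v (F v + G v)).
  rewrite big_sumType /= exprD -mulrA; congr (_ * _).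
    rewrite /ia -prodr_const big_mkcond /=; apply: eq_bigr => i _.
    by rewrite inE /F /G; case: int_active; rewrite ?mul1r ?subrK ?mul0r ?add0r.
  rewrite /ea; set S := [set j | _].
  rewrite -(cardsC S) addKn -!prodr_const.
  rewrite (big_mkcond (mem S)) (big_mkcond (mem (~: S))) -big_split /=.
  apply: eq_bigr => j _; rewrite !inE /F /G mul1r.
  by case: ext_active; rewrite /= ?mulr1 ?subrK ?mul1r ?addr0.
rewrite bigA_distr; apply: eq_bigr => W _.
have [/forallP ok|/forallPn[v bad]] := boolP (split_at p W).
  rewrite mul1r -prodr_const [RHS]big_mkcond /=; apply: eq_bigr => v _.
  have := ok v; rewrite /F /G; case: v => v; case: ifP => //= _.
  - by move->; rewrite mul1r.
  - by rewrite mul1r.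
  - by move->.
rewrite mul0r (bigD1 v) //= /F /G.
by case: v bad => v; rewrite negb_imply => /andP[];
  [move=> -> | move/negPf->] => /negPf->; rewrite !mul0r.
Qed.

Definition refold (U : {set 'I_(nvert A B)}) p : {ffun V -> 'I_(nvert A B)} :=
  [ffun v => fold_rank U (p v)].

Lemma refold_inj U : injective (refold U).
Proof.
move=> p q /ffunP eq_pq; apply/ffunP => v; apply: (@fold_rank_inj _ U).
by have := eq_pq v; rewrite !ffunE.
Qed.

Lemma refold_perms U p : (refold U p \in perms) = (p \in perms).
Proof.
rewrite !inE; apply/injectiveP/injectiveP => inj_p v w.
  by move=> eq_vw; apply: inj_p; rewrite !ffunE eq_vw.
by rewrite !ffunE => /fold_rank_inj/inj_p.
Qed.

Lemma split_at_refold (U : {set 'I_(nvert A B)}) p :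
  split_at p (p @^-1: U) = topA (refold U p).
Proof.
apply/forallP/forallP => [ok i|top [i|j]].
- apply/forallP => j; apply/implyP => Eij.
  rewrite !ffunE fold_rank_lt fold_ltE; apply/andP; split.
    have := ok (inl i); rewrite inE => /implyP ok_i.
    by apply/implyP => /ok_i/forallP/(_ j)/implyP; apply.
  have := ok (inr j); rewrite !inE => /implyP ok_j.
  by apply/implyP => /ok_j/forallP/(_ i)/implyP; apply.
- rewrite inE; apply/implyP => Ui; apply/forallP => j; apply/implyP => Eij.
  have /forallP/(_ j)/implyP/(_ Eij) := top i.
  by rewrite !ffunE fold_rank_lt fold_ltE Ui => /andP[].
- rewrite !inE; apply/implyP => Uj; apply/forallP => i; apply/implyP => Eij.
  have /forallP/(_ j)/implyP/(_ Eij) := top i.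
  by rewrite !ffunE fold_rank_lt fold_ltE Uj => /andP[].
Qed.

(* With y = x / (x - 1), so that x y = x + y, and denominators cleared. *)
Lemma activity_on_hyperbola (R : comNzRingType) (x : R) :
  \sum_(p in perms) x ^+ (ia E p + ea E p) * (x - 1) ^+ (#|B| - ea E p) =
  #|[set p in perms | topA p]|%:R * x ^+ nvert A B.
Proof.
under eq_bigr => p _ do rewrite activity_expansion.
transitivity (\sum_(p in perms) \sum_(U : {set 'I_(nvert A B)})
    (topA (refold U p))%:R * (x - 1) ^+ #|U|).
  apply: eq_bigr => p; rewrite inE => /injectiveP inj_p.
  have bij_p : bijective p.
    by apply: inj_card_bij => //; rewrite card_ord.
  have [q pK qK] := bij_p.
  rewrite (reindex (fun U : {set 'I_(nvert A B)} => p @^-1: U)) /=.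
    apply: eq_bigr => U _; rewrite split_at_refold on_card_preimset //.
    exact: onW_bij.
  exists (fun W => q @^-1: W) => W _; apply/setP => v; rewrite !inE.
    by rewrite qK.
  by rewrite pK.
rewrite exchange_big /=.
transitivity (\sum_(U : {set 'I_(nvert A B)})
    #|[set p in perms | topA p]|%:R * (x - 1) ^+ #|U|).
  apply: eq_bigr => U _; rewrite -mulr_suml; congr (_ * _).
  rewrite -sum1_card natr_sum.
  (* [refold U] permutes [perms], so the count does not depend on U. *)
  rewrite [RHS](reindex_inj (@refold_inj U)) /= [LHS]big_mkcond [RHS]big_mkcond.
  apply: eq_bigr => p _; rewrite [in RHS]in_set refold_perms.
  by case: (p \in _); case: topA.
rewrite -mulr_sumr; congr (_ * _).
transitivity (\prod_(t < nvert A B) ((x - 1) + 1)).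
  rewrite bigA_distr; apply: eq_bigr => U _.
  by rewrite -big_mkcond prodr_const.
by rewrite subrK prodr_const card_ord.
Qed.

Lemma tcoefE i j : tcoef E i j =
  ((nvert A B)`!)%:R^-1 * \sum_(p in perms) ((ia E p == i) && (ea E p == j))%:R.
Proof.
rewrite /tcoef /Ttilde coefZ coefCM coef_sum coef_sum; congr (_ * _).
apply: eq_bigr => p _; rewrite -polyC_exp coefCM coefXn.
by rewrite eq_sym; case: eqP => _; rewrite ?mulr1 ?mulr0 ?coef0 ?andbF ?andbT // coefXn eq_sym.
Qed.

(** When all of A is active, each neighbour of j in B lies above j, so exactly the isolated vertices
    of B are active and the value of [ea] is forced. *)
Lemma alt_numE : alt_num E =
  ((nvert A B)`!)%:R^-1 * #|[set p in perms | topA p]|%:R.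
Proof.
rewrite /alt_num tcoefE; congr (_ * _).
rewrite -[in RHS]sum1_card natr_sum [LHS]big_mkcond [RHS]big_mkcond; apply: eq_bigr => p _.
rewrite [in RHS]inE; case: (p \in _) => //=.
have -> : (ia E p == #|A|) = topA p.
  apply/eqP/forallP => [full i|top]; last first.
    by rewrite /ia -cardsT; apply: eq_card => i; rewrite !inE top.
  have /setP/(_ i) : [set i | int_active E p i] = setT.
    by apply/eqP; rewrite eqEcard subsetT cardsT -full leqnn.
  by rewrite !inE.
have [/forallP top|//] := boolP (topA p).
suff -> : ea E p = #|isolatedB E| by rewrite eqxx.
apply: eq_card => j; rewrite !inE; apply: eq_forallb => i.
case Eij: (E i j) => //=; apply/negbTE; rewrite -leqNgt ltnW //.
by have /forallP/(_ j)/implyP := top i; apply.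
Qed.

End Expansion.

Section NegativeBinomialSeries.

Variables (R : comNzRingType) (n : nat).

(* (1 - 'X)^-(r+1) truncated after degree n. *)
Definition negbin r : {poly R} := \poly_(k < n.+1) 'C(r + k, k)%:R.

(** This makes the truncation in [negbin] harmless up to degree n. *)
Lemma eq_coef_mul (s p q : {poly R}) k :
  (forall l, (l <= k)%N -> p`_l = q`_l) -> (s * p)`_k = (s * q)`_k.
Proof.
move=> eq_pq; rewrite !coefM; apply: eq_bigr => l _.
by rewrite eq_pq ?leq_subr.
Qed.

Lemma coef_negbinS r k : (k <= n)%N ->
  ((1 - 'X) * negbin r.+1)`_k = (negbin r)`_k.
Proof.
move=> lekn; rewrite mulrBl mul1r coefB coefXM !coef_poly !ltnS lekn.
case: k lekn => [|k] lekn /=; first by rewrite !bin0 subr0.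
by rewrite ltnW // addSn binS addnS natrD addrK.
Qed.

Lemma coef_negbinD d r k : (k <= n)%N ->
  ((1 - 'X) ^+ d * negbin (r + d))`_k = (negbin r)`_k.
Proof.
elim: d r k => [|d IHd] r k lekn; first by rewrite mul1r addn0.
rewrite exprSr -mulrA addnS.
rewrite (@eq_coef_mul _ _ (negbin (r + d))) ?IHd // => l lelk.
by rewrite coef_negbinS // (leq_trans lelk).
Qed.

(** Up to sign, ('X - 1)^(b-t) cancels b - t of the b + 1 factors in the denominator, leaving
    [negbin t], read at degree n - s - t. *)
Lemma coef_monomial_negbin s t b : (t <= b)%N ->
  (-1) ^+ b * ('X^(s + t) * ('X - 1) ^+ (b - t) * negbin b)`_n =
  if (s + t <= n)%N then 'C(n - s, t)%:R * (-1) ^+ t else 0.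
Proof.
move=> letb; rewrite -mulrA coefXnM; case: leqP => lest; last by rewrite mulr0.
have signC : (-1) ^+ (b - t) = ((-1) ^+ (b - t))%:P :> {poly R}.
  by rewrite polyC_exp polyCN.
rewrite -(opprB 1) [(- (1 - 'X)) ^+ _]exprNn signC -mulrA coefCM -{4}(subnKC letb).
rewrite coef_negbinD ?leq_subr // coef_poly ltnS leq_subr.
have letns : (t <= n - s)%N by rewrite leq_subRL // (leq_trans _ lest) ?leq_addr.
rewrite subnDA subnKC // bin_sub // mulrA -exprD -{1}(subnKC letb) -addnA addnn.
by rewrite exprD -mul2n mulnC exprM sqrr_sign mulr1 mulrC.
Qed.

End NegativeBinomialSeries.

Lemma sum_triangle_indicator (R : nzRingType) (F : nat -> nat -> R) s t h :
  \sum_(0 <= i < h.+1) \sum_(0 <= j < (h - i).+1)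
     F i j * ((s == i) && (t == j))%:R = if (s + t <= h)%N then F s t else 0.
Proof.
transitivity (\sum_(0 <= i < h.+1 | i == s)
                (if (t <= h - s)%N then F s t else 0)).
  rewrite [RHS]big_mkcond; apply: eq_bigr => i _; rewrite eq_sym.
  have [->|_] := eqVneq; last by rewrite big1 // => j _; rewrite mulr0.
  rewrite -[RHS](big_nat1_eq +%R (F s) t 0 (h - s).+1) [RHS]big_mkcond.
  by apply: eq_bigr => j _; rewrite eq_sym; case: eqP => _; rewrite ?mulr1 ?mulr0.
rewrite (big_nat1_eq +%R (fun=> if (t <= h - s)%N then F s t else 0)) /= ltnS.
have [lesh|ltsh] := leqP s h; first by rewrite leq_subRL.
by rewrite leqNgt (leq_trans ltsh) ?leq_addr.
Qed.

Lemma alternating_sum_coef (A B : finType) (E : A -> B -> bool) h :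
  \sum_(0 <= i < h.+1) \sum_(0 <= j < (h - i).+1)
     'C(h - i, j)%:R * (-1) ^+ j * tcoef E i j =
  (-1) ^+ #|B| * alt_num E * ('X^(nvert A B) * negbin rat h #|B|)`_h.
Proof.
(* Computed permutation by permutation, this coefficient is the alternating sum; computed by the
   hyperbola identity, it is the right-hand side. *)
transitivity (((nvert A B)`!)%:R^-1 * ((-1) ^+ #|B| *
   (\sum_(p in vperms A B) 'X^(ia E p + ea E p) * ('X - 1) ^+ (#|B| - ea E p)
      * negbin rat h #|B|)`_h)).
  rewrite coef_sum !mulr_sumr.
  transitivity (\sum_(0 <= i < h.+1) \sum_(0 <= j < (h - i).+1)
    \sum_(p in vperms A B) ((nvert A B)`!)%:R^-1 *
      ('C(h - i, j)%:R * (-1) ^+ j * ((ia E p == i) && (ea E p == j))%:R) : rat).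
    apply: eq_bigr => i _; apply: eq_bigr => j _.
    by rewrite tcoefE -mulr_sumr -mulr_sumr mulrCA.
  under eq_bigr => i _ do rewrite exchange_big.
  rewrite exchange_big /=; apply: eq_bigr => p _.
  under eq_bigr => i _ do rewrite -mulr_sumr.
  rewrite -mulr_sumr; congr (_ * _).
  by rewrite coef_monomial_negbin ?leq_ea //; exact: sum_triangle_indicator.
rewrite -mulr_suml activity_on_hyperbola alt_numE -polyC_natr.
rewrite -[_%:P * _ * _]mulrA coefCM !mulrA; congr (_ * _ * _); exact: mulrC.
Qed.

Theorem mainTheorem9 (A B : finType) (E : A -> B -> bool) (a b m : nat)
    (cardA : #|A| = a) (cardB : #|B| = b) (defm : m = (a + b)%N) :
  (forall h : nat, (h < m)%N ->
     \sum_(0 <= i < h.+1) \sum_(0 <= j < (h - i).+1)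
        'C(h - i, j)%:R * (-1) ^+ j * tcoef E i j = 0)
  /\
  (forall h k : nat, h = (m + k)%N ->
     \sum_(0 <= i < h.+1) \sum_(0 <= j < (h - i).+1)
        'C(h - i, j)%:R * (-1) ^+ j * tcoef E i j
     = (-1) ^+ b * alt_num E * 'C(b + k, k)%:R).
Proof.
have defV : nvert A B = m by rewrite /nvert card_sum cardA cardB.
split=> [h lthm|h k ->]; rewrite alternating_sum_coef defV cardB coefXnM.
  by rewrite lthm mulr0.
by rewrite ltnNge leq_addr /= addKn coef_poly ltnS leq_addl.
Qed.
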